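(* For every $m\in\mathbb N\setminus\{2,3,5\}$, in the Ulam–Rényi game over $\{0,\dots,2^m-1\}$ with at most $3$ lies there exists a perfect strategy all of whose questions are $4$-interval questions.
   Context: Game: Responder picks $x\in\mathcal U=\{0,\dots,2^m-1\}$; Questioner asks questions ''$x\in Q$?'' with $Q\subseteq\mathcal U$; Responder may lie at most 3 times. A state is a map $\sigma:\mathcal U\to\{0,1,2,3,4\}$ (number of answers falsified by each element, truncated at 4); the initial state is identically $0$; after question $Q$, $\sigma_{yes}(y)=\min\{\sigma(y)+[y\notin Q],4\}$, $\sigma_{no}(y)=\min\{\sigma(y)+[y\in Q],4\}$. A state is final if $|\{y:\sigma(y)<4\}|\le1$. A strategy of size $q$ is a complete binary tree of depth $q$ with internal nodes labelled by questions, edges by answers; it is winning if the state at every leaf is final. $N_{\min}(2^m,3)=\min\{q:2^{q-m}\ge\sum_{i=0}^3\binom qi\}$; a perfect strategy is a winning strategy for the initial state of size $N_{\min}(2^m,3)$. An interval is $\emptyset$ or $\{x\in\mathcal U:a\le x\le b\}$; a 4-interval question is a union of at most 4 intervals. *)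

(* Defs.v *)
From mathcomp Require Import all_boot.
Set Implicit Arguments. Unset Strict Implicit. Unset Printing Implicit Defensive.


(* A state: number of falsified answers for each element, truncated at 4. *)
Definition state (n : nat) := 'I_n -> nat.

Definition init_state (n : nat) : state n := fun _ => 0.

Definition sigma_yes n (s : state n) (Q : {set 'I_n}) : state n :=
  fun y => minn (s y + (y \notin Q)) 4.
Definition sigma_no n (s : state n) (Q : {set 'I_n}) : state n :=
  fun y => minn (s y + (y \in Q)) 4.

Definition final n (s : state n) : Prop := #|[set y : 'I_n | s y < 4]| <= 1.

(* Binary trees whose internal nodes are labelled by questions;
   the left subtree follows the answer "yes", the right one "no". *)
Inductive strategy (n : nat) : Type :=
| Leaf : strategy n
| Node : {set 'I_n} -> strategy n -> strategy n -> strategy n.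
Arguments Leaf {n}.

Fixpoint complete n (q : nat) (t : strategy n) : Prop :=
  match t, q with
  | Leaf, 0 => True
  | Node _ ty tn, q'.+1 => complete q' ty /\ complete q' tn
  | _, _ => False
  end.

Fixpoint winning n (s : state n) (t : strategy n) : Prop :=
  match t with
  | Leaf => final s
  | Node Q ty tn => winning (sigma_yes s Q) ty /\ winning (sigma_no s Q) tn
  end.

Fixpoint all_questions n (P : {set 'I_n} -> Prop) (t : strategy n) : Prop :=
  match t with
  | Leaf => True
  | Node Q ty tn => P Q /\ all_questions P ty /\ all_questions P tn
  end.

(* Berlekamp condition 2^(q-m) >= sum_{i=0}^3 C(q,i), written without
   truncated subtraction as 2^m * sum_{i=0}^3 C(q,i) <= 2^q. *)
Definition berlekamp (m q : nat) : bool :=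
  2 ^ m * (\sum_(i < 4) 'C(q, i)) <= 2 ^ q.

Definition is_Nmin (m q : nat) : Prop :=
  berlekamp m q /\ forall q', q' < q -> ~~ berlekamp m q'.

Definition interval n (I : {set 'I_n}) : Prop :=
  I = set0 \/ exists a b : nat, I = [set x : 'I_n | a <= x <= b].

Definition four_interval n (Q : {set 'I_n}) : Prop :=
  exists Is : seq {set 'I_n},
    size Is <= 4 /\ (forall I, I \in Is -> interval I) /\ Q = \bigcup_(I <- Is) I.

Definition perfect (m : nat) (t : strategy (2 ^ m)) : Prop :=
  exists q, is_Nmin m q /\ complete q t /\ winning (@init_state (2 ^ m)) t.

(* Main.v *)
(* List the surviving candidates in increasing order and record how many answers
   each of them falsifies: a position of the game becomes a word over {0,1,2,3},
   and a question a marking of its letters by bits.  A bit sequence with at most 8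
   changes around the circle, or its complement, is the indicator of a union of at
   most 4 intervals, so words may be rotated and reversed freely.

   Call pattern of a word the sequence of levels of its blocks of equal letters.
   A closed family of patterns is one in which every admissible choice of the
   numbers of elements to select in each level is realised by some 4-interval
   question whose two answers lead again to patterns of the family.  One such
   family allows exact halving of all levels; m halvings lead to the position
   (1, m, C(m,2), C(m,3)).  A second family allows arbitrary choices as long as
   level 0 is not cut, which reduces the rest of the game to a game on the four
   level sizes.

   In that game an element of level i has weight sum_(j <= 3-i) C(r,j) when r
   questions are left, and the elements of level 3, of weight 1, are used to
   split the total volume into equal halves.  For n >= 18 remaining questions,
   halving levels 1 and 2 works down to 10 questions, where every position with at
   most one element of level 0 and weight at most 847 below level 3 is won by a
   greedy strategy.  For 10 <= n < 18 the greedy strategy wins for the largest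
   admissible m, and therefore for all smaller ones. *)
Require Import Defs.
From Stdlib Require Import BinNat Nnat.
From mathcomp Require Import all_boot zify.
Set Implicit Arguments. Unset Strict Implicit. Unset Printing Implicit Defensive.

(** * Changes of a bit sequence and unions of intervals *)

Fixpoint changes (x : bool) (s : seq bool) : nat :=
  if s is y :: s' then (x != y) + changes y s' else 0.

Lemma changes_cat x s t : changes x (s ++ t) = changes x s + changes (last x s) t.
Proof. by elim: s x => [|y s IH] x //=; rewrite IH addnA. Qed.

Lemma changes_rcons x s y : changes x (rcons s y) = changes x s + (last x s != y).
Proof. by rewrite -cats1 changes_cat /= addn0. Qed.

Lemma changes_rev x s y : changes x (rcons (rev s) y) = changes y (rcons s x).
Proof.
elim: s x y => [|z s IH] x y /=; first by rewrite eq_sym.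
by rewrite rev_cons changes_rcons IH last_rcons addnC eq_sym.
Qed.

Lemma changes_negb x s : changes (~~ x) (map negb s) = changes x s.
Proof. by elim: s x => [|y s IH] x //=; rewrite IH; case: x y => [] []. Qed.

Lemma leq_changes x y s : changes x s <= (x != y) + changes y s.
Proof. by case: s => [|z s] //=; case: x y z => [] [] [] /=; lia. Qed.

Definition cyclic_changes (s : seq bool) : nat := changes (last true s) s.

Lemma cyclic_changesE s :
  cyclic_changes s = changes (last true s) (rcons s (last true s)).
Proof. by rewrite changes_rcons; case: s => [|y s] //=; rewrite eqxx addn0. Qed.

Lemma leq_cyclic_changes x s : cyclic_changes s <= changes x (rcons s x).
Proof.
rewrite changes_rcons addnC; case: s => [|y s] //.
exact: leq_changes.
Qed.

Lemma cyclic_changes_rot i s : cyclic_changes (rot i s) = cyclic_changes s.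
Proof.
rewrite -[in RHS](cat_take_drop i s) /rot /cyclic_changes !changes_cat !last_cat addnC.
by case: (take i s) (drop i s) => [|x t] [|y u] //=; rewrite addn0.
Qed.

Lemma cyclic_changes_rev s : cyclic_changes (rev s) = cyclic_changes s.
Proof.
rewrite cyclic_changesE changes_rev; case: s => [|y s] //.
by rewrite rev_cons last_rcons /cyclic_changes /= eqxx changes_rcons [RHS]addnC.
Qed.

Definition inside (i : nat) (p : nat * nat) : bool := p.1 <= i < p.2.

Definition shift (J : seq (nat * nat)) : seq (nat * nat) :=
  [seq (p.1.+1, p.2.+1) | p <- J].

Lemma has_inside_shift i J : has (inside i) (shift J) = (0 < i) && has (inside i.-1) J.
Proof. by rewrite has_map; case: i => [|i]; first elim: J. Qed.

(* When x = true, a run of ones enters s from the left and ends at position c. *)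
Lemma changes_runs x s : exists c J, [/\ x || (c == 0),
  (size J).*2 + x <= changes x (rcons s false)
  & forall i, nth false s i = (i < c) || has (inside i) J].
Proof.
elim: s x => [|b s IH] x.
  by exists 0, [::]; split=> [||i]; rewrite ?orbT ?nth_nil //; case: x.
have [c [J [bc szJ nJ]]] := IH b; case: b bc szJ => [_|/eqP c0] szJ; last first.
  exists 0, (shift J); split=> [||[|i]]; rewrite ?orbT ?has_inside_shift //=.
    by rewrite size_map; case: x; lia.
  by rewrite nJ c0.
case: x.
  exists c.+1, (shift J); split=> [||[|i]] //=; last by rewrite has_inside_shift nJ.
  by rewrite size_map.
exists 0, ((0, c.+1) :: shift J); split=> [||[|i]] //=.
  by rewrite size_map; lia.
by rewrite has_inside_shift nJ.
Qed.

Definition interval_union n (k : nat) (Q : {set 'I_n}) : Prop :=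
  exists Is : seq {set 'I_n},
    size Is <= k /\ (forall I, I \in Is -> interval I) /\ Q = \bigcup_(I <- Is) I.

Lemma interval_inside n p : interval [set x : 'I_n | inside x p].
Proof.
case: p => a [|b]; first by left; apply/setP=> x; rewrite !inE /inside ltn0 andbF.
by right; exists a, b; apply/setP=> x; rewrite !inE.
Qed.

Lemma changes_interval_union n k s : changes false (rcons s false) <= k.*2 ->
  interval_union k [set z : 'I_n | nth false s z].
Proof.
have [_ [J [/eqP-> szJ nJ]]] := changes_runs false s => le_k.
exists [seq [set x : 'I_n | inside x p] | p <- J]; split; first by rewrite size_map; lia.
split=> [I /mapP[p _ ->]|]; first exact: interval_inside.
apply/setP=> x; rewrite inE nJ bigcup_seq; apply/hasP/bigcupP => [[p pJ xp]|[I]].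
  by exists [set x : 'I_n | inside x p]; rewrite ?map_f ?inE.
by case/mapP=> p pJ ->; rewrite inE; exists p.
Qed.

Lemma cyclic_changes_interval_union n k s : size s = n -> cyclic_changes s <= k.*2 ->
  exists y, interval_union k [set z : 'I_n | nth false s z == y].
Proof.
move=> szs; rewrite cyclic_changesE; case: (last true s) => le_k.
  exists false; rewrite (_ : [set _ | _] = [set z : 'I_n | nth false (map negb s) z]).
    by apply: changes_interval_union; rewrite -[false]/(~~ true) -map_rcons changes_negb.
  by apply/setP=> z; rewrite !inE (nth_map false) ?szs //; case: (nth _ _ _).
exists true; rewrite (_ : [set _ | _] = [set z : 'I_n | nth false s z]).
  exact: changes_interval_union.
by apply/setP=> z; rewrite !inE eqb_id.
Qed.

(** * The game on words *)

(* A letter counts falsified answers, of which cap eliminate an element; its mark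
   tells whether the element is selected by the question. *)
Definition answer (cap : nat) (y : bool) (m : seq (nat * bool)) : seq nat :=
  [seq l <- [seq q.1 + (q.2 != y) | q <- m] | l < cap].

Lemma answer_cat cap y m1 m2 :
  answer cap y (m1 ++ m2) = answer cap y m1 ++ answer cap y m2.
Proof. by rewrite /answer map_cat filter_cat. Qed.

Lemma answer_rev cap y m : answer cap y (rev m) = rev (answer cap y m).
Proof. by rewrite /answer map_rev filter_rev. Qed.

Lemma answer_rot cap y i m : exists j, answer cap y (rot i m) = rot j (answer cap y m).
Proof.
exists (size (answer cap y (take i m))).
by rewrite {1}/rot answer_cat -rot_size_cat -answer_cat cat_take_drop.
Qed.

Fixpoint word_win (cap k r : nat) (w : seq nat) : Prop :=
  if r is r'.+1 then
    exists m, [/\ unzip1 m = w, cyclic_changes (unzip2 m) <= k.*2,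
      word_win cap k r' (answer cap true m) & word_win cap k r' (answer cap false m)]
  else size w <= 1.

Lemma word_win_rev cap k r w : word_win cap k r w -> word_win cap k r (rev w).
Proof.
elim: r w => [|r IH] w /=; first by rewrite size_rev.
case=> m [<- le_k wy wn]; exists (rev m).
by rewrite /unzip1 /unzip2 !map_rev cyclic_changes_rev !answer_rev; split=> //; apply: IH.
Qed.

Lemma word_win_rot cap k r i w : word_win cap k r w -> word_win cap k r (rot i w).
Proof.
elim: r i w => [|r IH] i w /=; first by rewrite size_rot.
case=> m [<- le_k wy wn]; exists (rot i m).
rewrite /unzip1 /unzip2 !map_rot cyclic_changes_rot.
have [jy ->] := answer_rot cap true i m; have [jn ->] := answer_rot cap false i m.
by split=> //; apply: IH.
Qed.

(* Elements outside a copy the mark of their predecessor, which creates no change. *)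
Lemma extend_marks (T : Type) (a : pred T) w (m : seq (T * bool)) x e :
  unzip1 m = filter a w ->
  exists M, [/\ unzip1 M = w, [seq q <- M | a q.1] = m
    & changes x (rcons (unzip2 M) e) = changes x (rcons (unzip2 m) e)].
Proof.
elim: w m x => [|l w IH] [|[l' b] m] x //=; first by exists [::].
- case: ifP => // al /(IH [::] x)[M [wE mE chE]].
  by exists ((l, x) :: M); rewrite /= al wE mE chE eqxx.
- case: ifP => al; first case=> -> /(IH m b)[M [wE mE chE]].
    by exists ((l, b) :: M); rewrite /= al wE mE chE.
  move=> /(IH ((l', b) :: m) x)[M [wE mE chE]].
  by exists ((l, x) :: M); rewrite /= al wE mE chE eqxx.
Qed.

Definition survivors n (s : state n) : seq nat := [seq l <- map s (enum 'I_n) | l < 4].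

Lemma final_survivors n (s : state n) : size (survivors s) <= 1 -> final s.
Proof.
rewrite /final cardE /survivors filter_map size_map enumT /enum_mem !size_filter.
by congr (_ <= _); apply: eq_count => z; rewrite /= inE.
Qed.

Lemma filter_minn_answer cap y M :
  [seq l <- [seq minn (q.1 + (q.2 != y)) cap | q <- M] | l < cap] =
  answer cap y [seq q <- M | q.1 < cap].
Proof.
elim: M => [|[l b] M IH] //=; rewrite IH /answer; case: (ltnP l cap) => l_cap /=.
  have -> : (minn (l + (b != y)) cap < cap) = (l + (b != y) < cap) by lia.
  by case: ifP => // lt; congr (_ :: _); lia.
by case: ifP => //; lia.
Qed.

Lemma size_marks n (s : state n) (M : seq (nat * bool)) :
  unzip1 M = map s (enum 'I_n) -> size (unzip2 M) = n.
Proof.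
by move=> ME; rewrite size_map -(size_map fst) [map _ _]ME size_map size_enum_ord.
Qed.

Lemma survivors_answer n (s t : state n) (M : seq (nat * bool)) y :
  unzip1 M = map s (enum 'I_n) ->
  (forall z, t z = minn (s z + (nth false (unzip2 M) z != y)) 4) ->
  survivors t = answer 4 y [seq q <- M | q.1 < 4].
Proof.
move=> ME tE; have szM := size_marks ME.
rewrite -filter_minn_answer /survivors; congr filter.
have -> : M = [seq (s z, nth false (unzip2 M) (val z)) | z <- enum 'I_n].
  rewrite -zip_map -ME (map_comp (nth false (unzip2 M)) val) val_enum_ord.
  by rewrite -szM -/(mkseq _ _) mkseq_nth zip_unzip.
by rewrite -[RHS]map_comp; apply: eq_map => z; rewrite tE.
Qed.

Theorem word_win_strategy k n r (s : state n) : word_win 4 k r (survivors s) ->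
  exists t, [/\ complete r t, winning s t & all_questions (interval_union k) t].
Proof.
elim: r s => [|r IH] s /= => [le1|[m [mE le_k wy wn]]].
  by exists Leaf; split=> //; apply: final_survivors.
pose x := last true (unzip2 m); have [M [ME MmE chM]] := extend_marks x x mE.
have szM := size_marks ME; have le_kM : cyclic_changes (unzip2 M) <= k.*2.
  by apply: leq_trans (leq_cyclic_changes x _) _; rewrite chM -cyclic_changesE.
have [y] := cyclic_changes_interval_union szM le_kM; set Q := [set _ | _] => QI.
have next z (t : state n) :
    (forall i, t i = minn (s i + (nth false (unzip2 M) i != z)) 4) ->
    exists u, [/\ complete r u, winning t u & all_questions (interval_union k) u].
  by move=> tE; apply: IH; rewrite (survivors_answer ME tE) MmE; case: z {tE}.
have [|ty [cy wty qy]] := next y (sigma_yes s Q).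
  by move=> i; rewrite /sigma_yes inE.
have [|tn [cn wtn qn]] := next (~~ y) (sigma_no s Q).
  by move=> i; rewrite /sigma_no inE; case: (y) (nth _ _ _) => [] [].
by exists (Node Q ty tn).
Qed.

(** * Patterns *)

(* Unlike has, it stops at the first hit when evaluated by value. *)
Fixpoint first_has (T : Type) (a : pred T) (s : seq T) : bool :=
  if s is x :: s' then if a x then true else first_has a s' else false.

Lemma first_hasE (T : Type) (a : pred T) s : first_has a s = has a s.
Proof. by elim: s => //= x s ->. Qed.

Section TallySeq.
Variables (T T' : eqType).
Implicit Types B : seq (T * nat).

Lemma tally_seq_cons p B : tally_seq (p :: B) = nseq p.2 p.1 ++ tally_seq B.
Proof. by []. Qed.

Lemma tally_seq_cat B C : tally_seq (B ++ C) = tally_seq B ++ tally_seq C.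
Proof. by rewrite /tally_seq map_cat flatten_cat. Qed.

Lemma tally_seq_rev B : tally_seq (rev B) = rev (tally_seq B).
Proof.
elim: B => [|p B IH] //; rewrite rev_cons -cats1 tally_seq_cat IH !tally_seq_cons rev_cat.
by rewrite rev_nseq cats0.
Qed.

Lemma map_tally_seq (f : T -> T') B :
  map f (tally_seq B) = tally_seq [seq (f p.1, p.2) | p <- B].
Proof.
rewrite /tally_seq map_flatten -!map_comp; congr flatten.
by apply: eq_map => p /=; rewrite map_nseq.
Qed.

Lemma filter_tally_seq (a : pred T) B :
  filter a (tally_seq B) = tally_seq [seq p <- B | a p.1].
Proof.
elim: B => [|p B IH] //=; rewrite tally_seq_cons filter_cat filter_nseq IH.
by case: (a p.1); rewrite ?mul1n.
Qed.

Lemma count_tally_seq (a : pred T) B :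
  count a (tally_seq B) = sumn [seq p.2 | p <- B & a p.1].
Proof. by rewrite -size_filter filter_tally_seq size_tally_seq. Qed.

(* Blocks may be empty, so a word has many patterns. *)
Definition has_pattern (p w : seq T) : Prop :=
  exists2 B : seq (T * nat), unzip1 B = p & tally_seq B = w.

Lemma has_pattern_rev p w : has_pattern p w -> has_pattern (rev p) (rev w).
Proof. by case=> B <- <-; exists (rev B); rewrite ?tally_seq_rev // /unzip1 map_rev. Qed.

Lemma has_pattern_rot i p w :
  has_pattern p w -> exists j, has_pattern (rot i p) (rot j w).
Proof.
case=> B <- <-; exists (size (tally_seq (take i B))), (rot i B).
  by rewrite /unzip1 map_rot.
by rewrite {1}/rot tally_seq_cat -rot_size_cat -tally_seq_cat cat_take_drop.
Qed.

Lemma has_pattern_nil p : has_pattern p [::].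
Proof.
exists [seq (l, 0) | l <- p]; last by elim: p.
by rewrite /unzip1 -map_comp map_id.
Qed.

Lemma has_pattern_cat p1 w1 p2 w2 :
  has_pattern p1 w1 -> has_pattern p2 w2 -> has_pattern (p1 ++ p2) (w1 ++ w2).
Proof.
case=> B1 <- <- [B2 <- <-]; exists (B1 ++ B2); last exact: tally_seq_cat.
by rewrite /unzip1 map_cat.
Qed.

Lemma has_pattern_nseq n l p w :
  has_pattern (l :: p) w -> has_pattern (l :: p) (nseq n l ++ w).
Proof.
case=> -[|[_ k] B] //= [-> <-] <-; exists ((l, n + k) :: B) => //.
by rewrite !tally_seq_cons nseqD -catA.
Qed.

Lemma all_has_pattern (a : pred T) p w : has_pattern p w -> all a p -> all a w.
Proof.
case=> B <- <- {p w}; elim: B => [|p B IH] //= /andP[ap /IH aB].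
by rewrite tally_seq_cons all_cat all_nseq ap orbT.
Qed.

Fixpoint embeds (p S : seq T) : bool :=
  if p is l :: p' then
    if l \in S then embeds p' (drop (index l S) S) else false
  else true.

Lemma embeds_has_pattern p S w : embeds p S -> has_pattern p w -> has_pattern S w.
Proof.
move=> + [B pE <-]; rewrite -{p}pE; elim: B S => [|[l n] B IH] S /=.
  by move=> _; apply: has_pattern_nil.
case: ifP => // lS /IH; rewrite drop_index // => /(has_pattern_nseq n).
move=> /(has_pattern_cat (has_pattern_nil (take (index l S) S))).
by rewrite -drop_index // cat_take_drop.
Qed.

Definition fits_in (F : seq (seq T)) (p : seq T) : bool :=
  first_has (fun i =>
      first_has (fun S => embeds (rot i p) S || embeds (rev (rot i p)) S) F)
    (iota 0 (size p).+1).

End TallySeq.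

Lemma has_pattern_map (T T' : eqType) (f : T -> T') p w :
  has_pattern p w -> has_pattern (map f p) (map f w).
Proof.
case=> B <- <-; exists [seq (f q.1, q.2) | q <- B]; rewrite ?map_tally_seq //.
by rewrite /unzip1 -!map_comp.
Qed.

Lemma has_pattern_filter (T : eqType) (a : pred T) p w :
  has_pattern p w -> has_pattern (filter a p) (filter a w).
Proof.
case=> B <- <-; exists [seq q <- B | a q.1]; rewrite ?filter_tally_seq //.
by rewrite /unzip1 filter_map.
Qed.

Lemma has_pattern_answer cap y p m :
  has_pattern p m -> has_pattern (answer cap y p) (answer cap y m).
Proof.
by move=> /(has_pattern_map (fun q => q.1 + (q.2 != y))) /has_pattern_filter; apply.
Qed.

Lemma changes_has_pattern x e p s :
  has_pattern p s -> changes x (rcons s e) <= changes x (rcons p e).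
Proof.
case=> B <- <- {p s}; elim: B x => [|[b n] B IH] x //=.
rewrite tally_seq_cons rcons_cat; case: n => [|n] /=.
  by apply: leq_trans (leq_changes _ b _) _; rewrite leq_add2l.
by rewrite leq_add2l; elim: n => [|n IHn] /=; rewrite ?eqxx ?IH.
Qed.

Lemma cyclic_changes_has_pattern p s :
  has_pattern p s -> cyclic_changes s <= cyclic_changes p.
Proof.
move=> ps; rewrite [leqRHS]cyclic_changesE.
exact: leq_trans (leq_cyclic_changes _ _) (changes_has_pattern _ _ ps).
Qed.

Lemma fits_in_word_win cap k r F p w : has_pattern p w -> fits_in F p ->
  (forall S v, S \in F -> has_pattern S v -> perm_eq v w -> word_win cap k r v) ->
  word_win cap k r w.
Proof.
move=> pw; rewrite /fits_in first_hasE => /hasP[i _].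
rewrite first_hasE => /hasP[S SF /orP emb] win.
have [j pj] := has_pattern_rot i pw.
rewrite -(rotK j w); apply: word_win_rot.
case: emb => /embeds_has_pattern emb; first by apply: win (emb _ pj) _; rewrite ?perm_rot.
rewrite -(revK (rot j w)); apply: word_win_rev.
by apply: win (emb _ (has_pattern_rev pj)) _; rewrite ?perm_rev ?perm_rot.
Qed.

(** * Closed families of patterns *)

Lemma count_unzip1 l (m : seq (nat * bool)) :
  count_mem l (unzip1 m) = count_mem (l, true) m + count_mem (l, false) m.
Proof.
elim: m => [|[j b] m IH] //=; rewrite IH !xpair_eqE.
by case: eqP => _; case: b; rewrite /=; lia.
Qed.

Lemma count_answer cap y l m : l < cap ->
  count_mem l (answer cap y m) =
  count_mem (l, y) m + (if l is j.+1 then count_mem (j, ~~ y) m else 0).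
Proof.
move=> l_cap; rewrite /answer count_filter.
rewrite (eq_count (a2 := pred1 l)) => [|i /=]; last by case: eqP => // ->.
rewrite count_map; elim: m => [|[j b] m IH]; first by case: l l_cap.
rewrite /= {}IH; case: l l_cap => [|l] _; rewrite !xpair_eqE.
  by case: b y => [] []; rewrite /= ?addn0 ?addn1 ?andbT ?andbF.
by case: b y => [] []; rewrite /= ?addn0 ?addn1 ?andbT ?andbF ?eqSS; lia.
Qed.

(* What a question does to a block: Some b marks all of it with b, and None cuts
   it in two.  All cuts in a level select the same number of elements, on the side
   given by the direction of the level. *)
Local Notation slice := (option bool).
Local Notation all_of := (Some true).
Local Notation none_of := (Some false).
Local Notation part_of := (@None bool).

Definition slice_block (c : nat) (d : bool) (x : slice) (p : nat * nat)
    : seq ((nat * bool) * nat) :=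
  if x is Some b then [:: ((p.1, b), p.2)] else
  let s := [:: ((p.1, true), c); ((p.1, false), p.2 - c)] in if d then s else rev s.

Fixpoint slice_blocks (c : nat -> nat) (d : nat -> bool) (v : nat -> seq slice)
    (B : seq (nat * nat)) : seq ((nat * bool) * nat) :=
  if B is p :: B' then
    slice_block (c p.1) (d p.1) (head none_of (v p.1)) p
      ++ slice_blocks c d [eta v with p.1 |-> behead (v p.1)] B'
  else [::].

Definition slice_pattern d v (S : seq nat) : seq (nat * bool) :=
  unzip1 (slice_blocks (fun=> 0) d v [seq (l, 0) | l <- S]).

Lemma unzip1_slice_blocks c d v B :
  unzip1 (slice_blocks c d v B) = slice_pattern d v (unzip1 B).
Proof.
rewrite /slice_pattern; elim: B v => [|[l n] B IH] v //=.
rewrite /unzip1 !map_cat; congr (_ ++ _); last exact: IH.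
by case: (head _ _) => //; rewrite /slice_block; case: (d l).
Qed.

Definition level (l : nat) (B : seq (nat * nat)) : seq nat :=
  [seq p.2 | p <- B & p.1 == l].

Lemma size_level l B : size (level l B) = count_mem l (unzip1 B).
Proof. by rewrite size_map size_filter count_map. Qed.

Lemma count_level l B : count_mem l (tally_seq B) = sumn (level l B).
Proof. exact: count_tally_seq. Qed.

Fixpoint selected (c : nat) (v : seq slice) (b : seq nat) : nat :=
  if b is n :: b' then
    (if head none_of v is Some y then y * n else c) + selected c (behead v) b'
  else 0.

Fixpoint cuttable (c : nat) (v : seq slice) (b : seq nat) : bool :=
  if b is n :: b' then
    (isSome (head none_of v) || (c <= n)) && cuttable c (behead v) b'
  else true.

Lemma cuttable_nil c b : cuttable c [::] b.
Proof. by elim: b. Qed.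

Lemma count_slice_blocks c d v B l :
  count_mem (l, true) (tally_seq (slice_blocks c d v B)) =
  selected (c l) (v l) (level l B).
Proof.
elim: B v => [|[j n] B IH] v //=.
rewrite tally_seq_cat count_cat IH /level /= [l == j]eq_sym.
set x := head _ _.
have -> : count_mem (l, true) (tally_seq (slice_block (c j) (d j) x (j, n))) =
    (j == l) * (if x is Some y then y * n else c j).
  rewrite count_tally_seq /slice_block.
  by case: x => [[]|]; last case: (d j);
    rewrite /= !xpair_eqE ?andbT ?andbF; case: eqP => _ /=; lia.
by rewrite {}/x; case: eqP => [->|] //=; rewrite mul1n.
Qed.

Lemma unzip1_tally_slice_blocks c d v B :
  (forall l, cuttable (c l) (v l) (level l B)) ->
  unzip1 (tally_seq (slice_blocks c d v B)) = tally_seq B.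
Proof.
elim: B v => [|[j n] B IH] v //= cut.
rewrite tally_seq_cat /unzip1 map_cat -/unzip1 IH => [|l]; last first.
  have := cut l; rewrite /level /= [l == j]eq_sym.
  by case: eqP => //= -> /andP[].
rewrite tally_seq_cons; congr (_ ++ _).
have := cut j; rewrite /level /= eqxx /= => /andP[cut_n _].
rewrite /slice_block; case: (head _ _) cut_n => [b _|/= le_c].
  by rewrite tally_seq_cons cats0 [LHS]map_nseq.
by case: (d j); rewrite /rev /= !tally_seq_cons cats0 [LHS]map_cat !map_nseq -nseqD /=;
  congr nseq; lia.
Qed.

(* The cuts select what the fully marked blocks leave over. *)
Definition cut_size (a : nat) (v : seq slice) (b : seq nat) : nat := a - selected 0 v b.

Definition realises (a : nat) (b : seq nat) (v : seq slice) : bool :=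
  cuttable (cut_size a v b) v b && (selected (cut_size a v b) v b == a).

Definition covers (o : seq (seq (seq slice))) (b : seq nat) (a : nat) : bool :=
  has (all (realises a b)) o.

Fixpoint choices (T : Type) (ss : seq (seq T)) : seq (seq T) :=
  if ss is s :: ss' then [seq x :: t | x <- s, t <- choices ss'] else [:: [::]].

Lemma choicesP (T : eqType) (x0 : T) (ss : seq (seq T)) (s : seq T) :
  reflect (size s = size ss /\ forall i, i < size ss -> nth x0 s i \in nth [::] ss i)
          (s \in choices ss).
Proof.
elim: ss s => [|A ss IH] s /=.
  by rewrite inE; apply: (iffP eqP) => [->|[/size0nil]].
apply: (iffP allpairsP) => [[[x t] /= [xA /IH[szt tss] ->]]|[]].
  by split=> [|[|i]] //=; rewrite ?szt //; apply: tss.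
case: s => [|x s] //= [szs] sin; exists (x, s); split=> //; first exact: (sin 0).
by apply/IH; split=> // i lt_i; apply: (sin i.+1).
Qed.

Section ClosedFamily.
Variables (cap k : nat) (F : seq (seq nat)).

Definition good_question (p : seq (nat * bool)) : bool :=
  [&& cyclic_changes (unzip2 p) <= k.*2, fits_in F (answer cap true p)
    & fits_in F (answer cap false p)].

(* The l-th entry of os lists, for the blocks of level l, sets of alternatives of
   which one realises the wanted number of elements as a whole. *)
Definition closed_family (os : seq (seq (seq (seq slice)))) : bool :=
  all (fun S => all (fun ts => first_has (fun vs => first_has (fun d =>
      good_question (slice_pattern (nth true d) (nth [::] vs) S))
    (choices (nseq cap [:: true; false]))) (choices ts)) (choices os)) F.

Definition next_count (x a : nat -> nat) (y : bool) (l : nat) : nat :=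
  (if y then a l else x l - a l) +
  (if l is j.+1 then (if y then x j - a j else a j) else 0).

Lemma count_answer_next (a : nat -> nat) y l m : l < cap ->
  (forall j, j < cap -> count_mem (j, true) m = a j) ->
  count_mem l (answer cap y m) = next_count (fun j => count_mem j (unzip1 m)) a y l.
Proof.
move=> l_cap aE; have le_cap j : j <= l -> count_mem (j, true) m = a j.
  by move=> le_l; apply/aE/(leq_ltn_trans le_l).
have falseE j : j <= l -> count_mem (j, false) m = count_mem j (unzip1 m) - a j.
  by move=> le_l; rewrite count_unzip1 le_cap // addKn.
rewrite count_answer // /next_count.
by case: l le_cap falseE {l_cap} => [|l] le_cap falseE; case: y; rewrite ?le_cap ?falseE.
Qed.

Lemma good_question_win r p m : has_pattern p m -> good_question p ->
  (forall y S w, S \in F -> has_pattern S w -> perm_eq w (answer cap y m) ->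
    word_win cap k r w) ->
  word_win cap k r.+1 (unzip1 m).
Proof.
move=> pm /and3P[le_k fit_y fit_n] win; exists m; split=> //.
- exact: leq_trans (cyclic_changes_has_pattern (has_pattern_map snd pm)) le_k.
- by apply: fits_in_word_win (has_pattern_answer cap true pm) fit_y _ => S v; apply: win.
- by apply: fits_in_word_win (has_pattern_answer cap false pm) fit_n _ => S v; apply: win.
Qed.

Variable os : seq (seq (seq (seq slice))).
Hypotheses (size_os : size os = cap) (closedF : closed_family os).

Lemma closed_family_good_question B (a : nat -> nat) : unzip1 B \in F ->
  (forall l, l < cap -> covers (nth [::] os l) (level l B) (a l)) ->
  exists p m, [/\ has_pattern p m, good_question p, unzip1 m = tally_seq B
    & forall l, l < cap -> count_mem (l, true) m = a l].
Proof.
move=> BF cov; pose fit l := all (realises (a l) (level l B)).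
pose t l := let o := nth [::] os l in nth [::] o (find (fit l) o).
have t_os : mkseq t cap \in choices os.
  apply/(choicesP [::]); rewrite size_mkseq; split=> // l; rewrite size_os => l_cap.
  by rewrite nth_mkseq // mem_nth // -has_find; apply: cov.
have := allP (allP closedF _ BF) _ t_os; rewrite first_hasE => /hasP[vs].
move=> /(choicesP [::])[]; rewrite first_hasE size_mkseq => szvs vs_t /hasP[d _ good].
pose v := nth [::] vs; pose c l := cut_size (a l) (v l) (level l B).
have real l : l < cap -> realises (a l) (level l B) (v l).
  move=> l_cap; apply: (allP (nth_find [::] (cov l l_cap))).
  by have := vs_t l l_cap; rewrite nth_mkseq.
exists (slice_pattern (nth true d) v (unzip1 B)).
exists (tally_seq (slice_blocks c (nth true d) v B)); split=> // [||l l_cap].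
- by exists (slice_blocks c (nth true d) v B); rewrite ?unzip1_slice_blocks.
- apply: unzip1_tally_slice_blocks => l; case: (ltnP l cap) => [/real/andP[]|ge_l] //.
  by rewrite /v nth_default ?cuttable_nil // szvs.
- by rewrite count_slice_blocks; have /andP[_ /eqP] := real l l_cap.
Qed.

Lemma closed_family_win r B (a : nat -> nat) : unzip1 B \in F ->
  (forall l, l < cap -> covers (nth [::] os l) (level l B) (a l)) ->
  (forall y S w, S \in F -> has_pattern S w ->
     (forall l, l < cap ->
        count_mem l w = next_count (fun j => count_mem j (tally_seq B)) a y l) ->
     word_win cap k r w) ->
  word_win cap k r.+1 (tally_seq B).
Proof.
move=> BF cov win.
have [p [m [pm good mE aE]]] := closed_family_good_question BF cov.
rewrite -mE; apply: good_question_win pm good _ => y S w SF Sw /permP w_answer.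
by apply: win Sw _ => // l l_cap; rewrite w_answer -mE; apply: count_answer_next.
Qed.

End ClosedFamily.

(** * The two closed families *)

Definition one_all : seq (seq (seq slice)) := [:: [:: [:: all_of]]].

Definition one_cut : seq (seq (seq slice)) := [:: [:: [:: part_of]]].

Definition two_any : seq (seq (seq slice)) :=
  [:: [:: [:: part_of; none_of]; [:: none_of; part_of]];
      [:: [:: part_of; all_of]; [:: all_of; part_of]];
      [:: [:: part_of; none_of]; [:: part_of; all_of]];
      [:: [:: none_of; part_of]; [:: all_of; part_of]]].

Definition three_prefix : seq (seq (seq slice)) :=
  [:: [:: [:: part_of; none_of; none_of]]; [:: [:: all_of; part_of; none_of]];
      [:: [:: all_of; all_of; part_of]]].

Definition two_half : seq (seq (seq slice)) :=
  [:: [:: [:: part_of; none_of]; [:: part_of; all_of]];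
      [:: [:: none_of; part_of]; [:: all_of; part_of]]].

Definition three_half : seq (seq (seq slice)) :=
  [:: [seq [:: part_of; x; y] | x <- [:: all_of; none_of], y <- [:: all_of; none_of]];
      [seq [:: x; part_of; y] | x <- [:: all_of; none_of], y <- [:: all_of; none_of]];
      [seq [:: x; y; part_of] | x <- [:: all_of; none_of], y <- [:: all_of; none_of]];
      [:: [:: part_of; all_of; none_of]; [:: part_of; none_of; all_of];
          [:: all_of; part_of; none_of]; [:: none_of; part_of; all_of];
          [:: all_of; none_of; part_of]; [:: none_of; all_of; part_of]]].

Lemma covers_one_all b : size b = 1 -> covers one_all b (sumn b).
Proof. by case: b => [|b0 []] // _; rewrite /covers /= /realises /cut_size /=; lia. Qed.

Lemma covers_one_cut b a : size b = 1 -> a <= sumn b -> covers one_cut b a.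
Proof. by case: b => [|b0 []] // _; rewrite /covers /= /realises /cut_size /=; lia. Qed.

Lemma covers_two_any b a : size b = 2 -> a <= sumn b -> covers two_any b a.
Proof.
by case: b => [|b0 [|b1 []]] // _; rewrite /covers /= /realises /cut_size /=; lia.
Qed.

Lemma covers_three_prefix b a : size b = 3 -> a <= sumn b -> covers three_prefix b a.
Proof.
by case: b => [|b0 [|b1 [|b2 []]]] // _; rewrite /covers /= /realises /cut_size /=; lia.
Qed.

Lemma covers_two_half b a : size b = 2 -> sumn b = 2 * a -> covers two_half b a.
Proof.
by case: b => [|b0 [|b1 []]] // _; rewrite /covers /= /realises /cut_size /=; lia.
Qed.

Lemma covers_three_half b a : size b = 3 -> sumn b = 2 * a -> covers three_half b a.
Proof.
case: b => [|b0 [|b1 [|b2 []]]] //= _ sum_b.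
have half i : i < 4 -> all (realises a [:: b0; b1; b2]) (nth [::] three_half i) ->
    covers three_half [:: b0; b1; b2] a.
  by move=> i4 real; apply/hasP; exists (nth [::] three_half i); rewrite ?mem_nth.
case: (leqP a b0) => h0; last case: (leqP a b1) => h1; last case: (leqP a b2) => h2.
- by apply: (half 0); rewrite //= /realises /cut_size /=; lia.
- by apply: (half 1); rewrite //= /realises /cut_size /=; lia.
- by apply: (half 2); rewrite //= /realises /cut_size /=; lia.
- by apply: (half 3); rewrite //= /realises /cut_size /=; lia.
Qed.

(* Found by computing a greatest fixed point over all cyclic patterns with at
   most 1, 2, 3, 3 blocks of the respective levels. *)
Definition endgame_patterns : seq (seq nat) :=
  [:: [:: 2; 3; 0; 1; 2; 1; 3; 2; 3]; [:: 0; 1; 2; 3; 1; 2; 3; 2; 3];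
      [:: 0; 1; 2; 3; 2; 1; 3; 2; 3]; [:: 0; 1; 2; 3; 2; 3; 1; 2; 3];
      [:: 1; 0; 3; 1; 2; 3; 2; 3; 2]; [:: 0; 1; 3; 2; 1; 2; 3; 2; 3];
      [:: 0; 1; 3; 2; 3; 2; 1; 2; 3]].

Definition halving_patterns : seq (seq nat) :=
  [:: [:: 0; 1; 2; 3; 2; 3; 1; 2]; [:: 0; 1; 3; 2; 3; 2; 1; 2];
      [:: 0; 1; 3; 2; 1; 2; 3; 2]; [:: 0; 1; 2; 3; 2; 1; 3; 2];
      [:: 0; 1; 2; 3; 1; 2; 3; 2]].

Lemma endgame_closed :
  closed_family 4 4 endgame_patterns [:: one_all; two_any; three_prefix; three_prefix].
Proof. by vm_compute. Qed.

Lemma halving_closed :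
  closed_family 4 4 halving_patterns [:: one_cut; two_half; three_half; two_half].
Proof. by vm_compute. Qed.

Lemma halving_endgame : all (fits_in endgame_patterns) halving_patterns.
Proof. by vm_compute. Qed.

Lemma size_level_family F ns B l :
  all (fun S => [seq count_mem i S | i <- iota 0 (size ns)] == ns) F ->
  unzip1 B \in F -> l < size ns -> size (level l B) = nth 0 ns l.
Proof.
move=> /allP nsE /nsE /eqP {nsE}nsE l_ns; rewrite size_level -[in RHS]nsE.
by rewrite (nth_map 0) ?size_iota // nth_iota.
Qed.

Lemma size_count_levels cap w : all (fun l => l < cap) w ->
  size w = \sum_(l < cap) count_mem (val l) w.
Proof.
elim: w => [|i w IH] /=; first by rewrite big1.
case/andP=> i_cap /IH->; rewrite big_split /= -add1n; congr (_ + _).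
rewrite (bigD1 (Ordinal i_cap)) //= eqxx big1 // => j.
by rewrite -val_eqE /= eq_sym => /negbTE->.
Qed.

(* Level l has x_l elements, of which a_l are selected; level 0 is never cut. *)
Fixpoint sizes_win (r x0 x1 x2 x3 : nat) : Prop :=
  if r is r'.+1 then
    exists a1 a2 a3,
      [/\ a1 <= x1, a2 <= x2, a3 <= x3,
          sizes_win r' x0 a1 (a2 + (x1 - a1)) (a3 + (x2 - a2))
        & sizes_win r' 0 (x1 - a1 + x0) (x2 - a2 + a1) (x3 - a3 + a2)]
  else x0 + x1 + x2 + x3 <= 1.

Lemma endgame_win r S w : S \in endgame_patterns -> has_pattern S w ->
  sizes_win r (count_mem 0 w) (count_mem 1 w) (count_mem 2 w) (count_mem 3 w) ->
  word_win 4 4 r w.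
Proof.
elim: r S w => [|r IH] S w SF Sw.
  rewrite /= (@size_count_levels 4) ?big_ord_recl ?big_ord0 /= ?addn0 ?addnA //.
  by apply: all_has_pattern Sw _; apply/allP: SF; vm_compute.
case: Sw SF => B <- <- BF [a1 [a2 [a3 [le1 le2 le3 wy wn]]]].
have size_l := size_level_family (_ : all (fun S => _ == [:: 1; 2; 3; 3]) _) BF.
pose a := nth 0 [:: count_mem 0 (tally_seq B); a1; a2; a3].
apply: (closed_family_win _ endgame_closed (a := a) BF) => //.
  rewrite !count_level in le1 le2 le3; rewrite /a count_level.
  case=> [|[|[|[|l]]]] //= _; rewrite ?addn0.
  - by apply: covers_one_all; rewrite size_l.
  - by apply: covers_two_any; rewrite ?size_l.
  - by apply: covers_three_prefix; rewrite ?size_l.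
  - by apply: covers_three_prefix; rewrite ?size_l.
move=> y {}S {}w SF Sw countE; apply: IH SF Sw _; rewrite !countE // /next_count /a /=.
by case: (y); rewrite ?subnn ?addn0.
Qed.

Lemma halving_win k j r S w : S \in halving_patterns -> has_pattern S w ->
  (forall l, l < 4 -> count_mem l w = 2 ^ k * 'C(j, l)) ->
  sizes_win r 1 (j + k) 'C(j + k, 2) 'C(j + k, 3) -> word_win 4 4 (k + r) w.
Proof.
elim: k j S w => [|k IH] j S w SF Sw countE win.
  rewrite addn0 in win; apply: (fits_in_word_win Sw) => [|S' v S'F S'v /permP vw].
    by move: SF; apply/allP; exact: halving_endgame.
  by apply: endgame_win S'F S'v _; rewrite !vw !countE // bin0 bin1 expn0 !mul1n.
case: Sw SF countE => B <- <- BF countE; rewrite addSn.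
have size_l := size_level_family (_ : all (fun S => _ == [:: 1; 2; 3; 2]) _) BF.
pose a l := 2 ^ k * 'C(j, l).
have sumE l : l < 4 -> sumn (level l B) = 2 * a l.
  by move=> l4; rewrite -count_level countE // expnS mulnA.
apply: (closed_family_win _ halving_closed (a := a) BF) => //.
  case=> [|[|[|[|l]]]] //= _.
  - by apply: covers_one_cut; rewrite ?size_l // sumE // leq_pmull.
  - by apply: covers_two_half; rewrite ?size_l ?sumE.
  - by apply: covers_three_half; rewrite ?size_l ?sumE.
  - by apply: covers_two_half; rewrite ?size_l ?sumE.
have restE l : l < 4 -> count_mem l (tally_seq B) - a l = a l.
  by move=> l4; rewrite countE // expnS /a; lia.
move=> y {}S {}w SF Sw nextE; apply: (IH j.+1 S) => // [l l4|]; last by rewrite addSnnS.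
rewrite nextE // /next_count; case: l l4 => [|l] l4.
  by rewrite restE // if_same addn0 /a !bin0.
by rewrite !restE ?(ltnW l4) // !if_same binS mulnDr.
Qed.

Lemma initial_word_win m r :
  sizes_win r 1 m 'C(m, 2) 'C(m, 3) -> word_win 4 4 (m + r) (nseq (2 ^ m) 0).
Proof.
move=> win; apply: (@halving_win m 0 r [:: 0; 1; 2; 3; 2; 3; 1; 2]) => // [|l _].
  rewrite -[nseq _ _]cats0; apply: (@has_pattern_nseq _ _ 0).
  exact: has_pattern_nil.
by rewrite count_nseq; case: l => [|l]; rewrite /= ?mul1n ?bin0 ?muln1 ?muln0.
Qed.

Lemma survivors_init n : survivors (@init_state n) = nseq n 0.
Proof.
by rewrite -[in RHS](size_enum_ord n) /survivors; elim: (enum _) => //= z s ->.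
Qed.

Theorem perfect_strategy m r :
  is_Nmin m (m + r) -> sizes_win r 1 m 'C(m, 2) 'C(m, 3) ->
  exists t : strategy (2 ^ m), perfect t /\ all_questions (@four_interval (2 ^ m)) t.
Proof.
move=> Nmin /initial_word_win win.
have [|t [ct wt qt]] := @word_win_strategy 4 (2 ^ m) (m + r) (@init_state _).
  by rewrite survivors_init.
by exists t; split=> //; exists (m + r).
Qed.

(** * Volumes *)

Lemma leq_sizes_win r x0 x1 x2 x3 y0 y1 y2 y3 :
  y0 <= x0 -> y1 <= x1 -> y2 <= x2 -> y3 <= x3 ->
  sizes_win r x0 x1 x2 x3 -> sizes_win r y0 y1 y2 y3.
Proof.
elim: r x0 x1 x2 x3 y0 y1 y2 y3 => [|r IH] x0 x1 x2 x3 y0 y1 y2 y3 l0 l1 l2 l3 /=.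
  by move=> ?; lia.
case=> a1 [a2 [a3 [m1 m2 m3 wy wn]]].
exists (minn a1 y1), (minn a2 y2), (minn a3 y3); split; try lia.
  by apply: IH wy; lia.
by apply: IH wn; lia.
Qed.

(* The ways to tell at most e lies in r answers, i.e. a Hamming ball of radius e. *)
Fixpoint ball (e r : nat) : nat :=
  if e is e'.+1 then ball e' r + 'C(r, e) else 1.

Lemma ballE e r : ball e r = \sum_(i < e.+1) 'C(r, i).
Proof. by elim: e => [|e IH] /=; rewrite big_ord_recr ?IH // big_ord0 bin0. Qed.

Lemma ball1 r : ball 1 r = r.+1.
Proof. by rewrite /= bin1. Qed.

Lemma ballS e r : ball e.+1 r.+1 = ball e.+1 r + ball e r.
Proof.
elim: e => [|e IH]; first by rewrite !ball1 addn1.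
by rewrite -[LHS]/(ball e.+1 r.+1 + 'C(r.+1, e.+2)) IH binS /=; lia.
Qed.

Lemma leq_ball e r s : r <= s -> ball e r <= ball e s.
Proof. by move=> le_rs; elim: e => [|e IH] //=; rewrite leq_add // leq_bin2l. Qed.

Lemma ballD e m n : ball e (m + n) = \sum_(i < e.+1) 'C(m, i) * ball (e - i) n.
Proof.
elim: e => [|e IH]; first by rewrite big_ord_recr big_ord0 /= bin0.
rewrite [LHS]/= -Vandermonde [X in _ + X]big_ord_recr [RHS]big_ord_recr /= subnn bin0.
rewrite IH addnA -big_split /=; congr (_ + _); apply: eq_bigr => i _.
by rewrite -mulnDr subSn // -ltnS.
Qed.

(* An element of level i, which admits 3 - i more lies, has weight ball (3 - i) r. *)
Definition low_volume (r x0 x1 x2 : nat) : nat :=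
  ball 3 r * x0 + ball 2 r * x1 + ball 1 r * x2.

Lemma low_volume_binomial m n : low_volume n 1 m 'C(m, 2) + 'C(m, 3) = ball 3 (m + n).
Proof. by rewrite ballD !big_ord_recr big_ord0 /low_volume /= bin0 !bin1; lia. Qed.

Lemma low_volumeS r x0 a1 u1 a2 u2 :
  low_volume r.+1 x0 (a1 + u1) (a2 + u2) =
  low_volume r x0 a1 (a2 + u1) + u2 + (low_volume r 0 (u1 + x0) (u2 + a1) + a2).
Proof. by rewrite /low_volume !ballS /=; lia. Qed.

(* Elements of level 3 have weight 1, so they can fill up any volume. *)
Definition fillable (r x0 x1 x2 : nat) : Prop :=
  forall x3, low_volume r x0 x1 x2 + x3 <= 2 ^ r -> sizes_win r x0 x1 x2 x3.

Lemma fillable_split r x0 a1 u1 a2 u2 :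
  low_volume r x0 a1 (a2 + u1) + u2 <= 2 ^ r ->
  low_volume r 0 (u1 + x0) (u2 + a1) + a2 <= 2 ^ r ->
  fillable r x0 a1 (a2 + u1) -> fillable r 0 (u1 + x0) (u2 + a1) ->
  fillable r.+1 x0 (a1 + u1) (a2 + u2).
Proof.
move=> vy vn fill_y fill_n x3; rewrite low_volumeS expnS => vol.
exists a1, a2, (minn x3 (2 ^ r - (low_volume r x0 a1 (a2 + u1) + u2))).
by rewrite !addKn; split; try lia; [apply: fill_y | apply: fill_n]; lia.
Qed.

Lemma low_volume_halves r x0 a1 e1 a2 e2 V : x0 <= 1 -> e1 <= 1 -> e2 <= 1 ->
  low_volume r.+1 x0 (a1 + (a1 + e1)) (a2 + (a2 + e2)) + ball 3 r <= (2 * V).+1 ->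
  low_volume r x0 a1 (a2 + (a1 + e1)) + (a2 + e2) <= V /\
  low_volume r 0 (a1 + e1 + x0) (a2 + e2 + a1) + a2 <= V.
Proof.
rewrite low_volumeS /low_volume ball1 [ball 3 r]/= [ball 2 r]/= bin1.
move: ('C(r, 2)) ('C(r, 3)) => b2 b3.
case: x0 => [|[|//]] _; case: e1 => [|[|//]] _; case: e2 => [|[|//]] _ leV;
  by split; lia.
Qed.

(* Halving levels 1 and 2 and rounding costs at most one element of each level. *)
Lemma fillable_halve r T : T + low_volume r 1 1 1 <= 2 ^ r ->
  (forall x0 x1 x2, x0 <= 1 ->
     low_volume r x0 x1 x2 <= T + low_volume r 1 1 1 -> fillable r x0 x1 x2) ->
  forall x0 x1 x2, x0 <= 1 ->
    low_volume r.+1 x0 x1 x2 <= 2 * T + low_volume r.+1 1 1 1 -> fillable r.+1 x0 x1 x2.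
Proof.
move=> leT fill x0 x1 x2 x0_le1.
have halves x : x = x./2 + (x./2 + odd x) by have := odd_double_half x; lia.
rewrite (halves x1) (halves x2); move: (x1./2) (x2./2) => a1 a2 le_vol.
have [|||vy vn] := @low_volume_halves r x0 a1 (odd x1) a2 (odd x2)
    (T + low_volume r 1 1 1) x0_le1; rewrite ?leq_b1 //.
  by move: le_vol; rewrite /low_volume !ballS !muln1 /=; lia.
by apply: fillable_split; try apply: fill; lia.
Qed.

(** * A greedy strategy in binary arithmetic *)

Local Notation low_sizes := (N * N * N)%type.

Section Greedy.
Local Open Scope N_scope.

Definition volume (w x : low_sizes) : N := w.1.1 * x.1.1 + w.1.2 * x.1.2 + w.2 * x.2.

Definition sizes_yes (x : low_sizes) (a : N * N) : low_sizes :=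
  (x.1.1, a.1, a.2 + (x.1.2 - a.1)).

Definition sizes_no (x : low_sizes) (a : N * N) : low_sizes :=
  (0, x.1.2 - a.1 + x.1.1, x.2 - a.2 + a.1).

Definition volume_yes w (x : low_sizes) a : N := volume w (sizes_yes x a) + (x.2 - a.2).
Definition volume_no w (x : low_sizes) a : N := volume w (sizes_no x a) + a.2.

Definition legal (w : low_sizes) (bound : N) (x : low_sizes) (a : N * N) : bool :=
  [&& a.1 <=? x.1.2, a.2 <=? x.2, volume_yes w x a <=? bound & volume_no w x a <=? bound].

Definition near_halves (x : low_sizes) : seq (N * N) :=
  let near n := let h := N.div2 n in [:: h - 1; h; h + 1] in
  [seq (a1, a2) | a1 <- near x.1.2, a2 <- near x.2].

Definition imbalance w x a : N :=
  (volume_yes w x a - volume_no w x a) + (volume_no w x a - volume_yes w x a).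

Definition greedy_move w bound (x : low_sizes) : N * N :=
  let ms := [seq (imbalance w x a, a) | a <- near_halves x & legal w bound x a] in
  (foldr (fun a b => if a.1 <=? b.1 then a else b) (head (0, (0, 0)) ms) ms).2.

End Greedy.

Definition weights (r : nat) : low_sizes :=
  (N.of_nat (ball 3 r), N.of_nat (ball 2 r), N.of_nat (ball 1 r)).

Fixpoint greedy_wins (r : nat) (xs : seq low_sizes) : bool :=
  if r is r'.+1 then
    let w := weights r' in let bound := N.of_nat (2 ^ r') in
    let ms := [seq (x, greedy_move w bound x) | x <- xs] in
    all (fun t => legal w bound t.1 t.2) ms &&
    greedy_wins r' (undup ([seq sizes_yes t.1 t.2 | t <- ms]
                             ++ [seq sizes_no t.1 t.2 | t <- ms]))
  else true.

Definition fillableN (r : nat) (x : low_sizes) : Prop :=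
  fillable r (N.to_nat x.1.1) (N.to_nat x.1.2) (N.to_nat x.2).

Lemma legal_fillable r x a : legal (weights r) (N.of_nat (2 ^ r)) x a ->
  fillableN r (sizes_yes x a) -> fillableN r (sizes_no x a) -> fillableN r.+1 x.
Proof.
case: x a => [[x0 x1] x2] [a1 a2].
rewrite /legal /volume_yes /volume_no /volume /sizes_yes /sizes_no /weights.
rewrite /fillableN /fst /snd.
case/and4P=> /N.leb_spec0 le1 /N.leb_spec0 le2 /N.leb_spec0 vy /N.leb_spec0 vn.
rewrite !N2Nat.inj_add !N2Nat.inj_sub => fill_y fill_n.
rewrite -(subnKC (_ : N.to_nat a1 <= N.to_nat x1)); last by lia.
rewrite -(subnKC (_ : N.to_nat a2 <= N.to_nat x2)); last by lia.
by apply: fillable_split => //; rewrite /low_volume; lia.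
Qed.

Lemma greedy_winsP r xs : greedy_wins r xs -> forall x, x \in xs -> fillableN r x.
Proof.
elim: r xs => [|r IH] xs /=.
  by move=> _ x _ x3; rewrite /low_volume /= !bin0n expn0; lia.
set move := greedy_move _ _ => /andP[/allP legal_move /IH win] x xs_x.
have ms_x : (x, move x) \in [seq (x, move x) | x <- xs] by apply: map_f.
apply: legal_fillable (legal_move _ ms_x) _ _; apply: win; rewrite mem_undup mem_cat.
  by rewrite (map_f (fun t => sizes_yes t.1 t.2) ms_x).
by rewrite (map_f (fun t => sizes_no t.1 t.2) ms_x) orbT.
Qed.

Definition up_to (n : nat) : seq N := map N.of_nat (iota 0 n.+1).

Lemma mem_up_to i n : i <= n -> N.of_nat i \in up_to n.
Proof. by move=> le_n; rewrite map_f // mem_iota. Qed.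

Definition base_states : seq low_sizes :=
  [seq x <- [seq (p, x2) | p <- [seq (x0, x1) | x0 <- up_to 1, x1 <- up_to 15],
                           x2 <- up_to 77]
   | (volume (weights 10) x <=? 847)%num].

Lemma greedy_wins_base : greedy_wins 10 base_states.
Proof. by vm_compute. Qed.

Lemma fillable_base x0 x1 x2 :
  x0 <= 1 -> low_volume 10 x0 x1 x2 <= 847 -> fillable 10 x0 x1 x2.
Proof.
move=> x0_le1 le847; have le_base : 176 * x0 + 56 * x1 + 11 * x2 <= 847 := le847.
have := greedy_winsP greedy_wins_base (x := (N.of_nat x0, N.of_nat x1, N.of_nat x2)).
rewrite /fillableN /= !Nat2N.id; apply; rewrite mem_filter; apply/andP; split.
  move: le847; rewrite /low_volume /volume /weights /fst /snd => le847.
  by apply/N.leb_spec0; lia.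
by do 2?[apply: allpairs_f]; apply: mem_up_to; lia.
Qed.

Lemma leq_low_volume_ones j : low_volume (10 + j) 1 1 1 <= 243 * 2 ^ j.
Proof.
elim: j => [|j IH]; first by vm_compute.
rewrite addnS expnS; move: (10 + j) IH => r IH.
have : low_volume r.+1 1 1 1 <= 2 * low_volume r 1 1 1.
  by rewrite /low_volume !ballS !muln1 /=; lia.
by lia.
Qed.

(* 847 = 604 + low_volume 10 1 1 1, and 604 / 1024 = 1 - 105 / 256 is the share of
   the volume that ball3_leq_bin3 leaves to the levels below 3. *)
Lemma fillable_low_volume j x0 x1 x2 : x0 <= 1 ->
  low_volume (10 + j) x0 x1 x2 <= 604 * 2 ^ j + low_volume (10 + j) 1 1 1 ->
  fillable (10 + j) x0 x1 x2.
Proof.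
elim: j x0 x1 x2 => [|j IH] x0 x1 x2 x0_le1; first by rewrite addn0; apply: fillable_base.
rewrite addnS expnS mulnCA => leV; apply: (fillable_halve _ IH) => //.
by have := leq_low_volume_ones j; rewrite expnD (_ : 2 ^ 10 = 1024) //; lia.
Qed.

(** * Perfect strategies *)

Lemma bin2_square m : 2 * 'C(m, 2) + m = m ^ 2.
Proof.
have := bin_ffact m 2; case: m => // m.
by rewrite !ffactnS ffactn0 !factS fact0 !expnS expn0 /=; lia.
Qed.

Lemma bin3_cube m : 6 * 'C(m, 3) + 3 * m ^ 2 = m ^ 3 + 2 * m.
Proof.
have := bin_ffact m 3; case: m => [|[|m]] //.
by rewrite !ffactnS ffactn0 !factS fact0 !expnS !expn0 /=; lia.
Qed.

Lemma ball3_cube r : 6 * ball 3 r = r ^ 3 + 5 * r + 6.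
Proof. by have := bin2_square r; have := bin3_cube r; rewrite /= bin1; lia. Qed.

Lemma ball3_leq_exp2 n s : 18 <= n -> s <= 5 * n -> ball 3 s <= 604 * 2 ^ (n - 10).
Proof.
move=> n18 /(leq_ball 3)/leq_trans; apply.
rewrite -(leq_pmul2l (_ : 0 < 6)) // ball3_cube.
elim: n n18 => // n IH; rewrite leq_eqVlt => /predU1P[<-|n18]; first by vm_compute.
have n10 : 10 <= n by lia.
have := IH n18; rewrite (subSn n10) [2 ^ _.+1]expnS; move: (2 ^ (n - 10)) => p.
by rewrite !expnS !expn0 !muln1; nia.
Qed.

Lemma ball3_leq_bin3 m n : 18 <= n -> 4 * n <= m -> 105 * ball 3 (m + n) <= 256 * 'C(m, 3).
Proof.
move=> n18 le_m; have binE := bin3_cube m; have ballE := ball3_cube (m + n).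
have cubes : 64 * (m + n) ^ 3 <= 125 * m ^ 3.
  by rewrite -(@expnMn 4 _ 3) -(@expnMn 5 _ 3) leq_exp2r //; lia.
have m72 : 72 <= m by lia.
have le_cube : 72 * m ^ 2 <= m ^ 3 by rewrite (expnS m 2) leq_mul2r m72 orbT.
have le_square : 72 * m <= m ^ 2 by rewrite leq_mul2r m72 orbT.
by lia.
Qed.

Lemma sizes_win_ge18 m n : 18 <= n -> ball 3 (m + n) <= 2 ^ n ->
  sizes_win n 1 m 'C(m, 2) 'C(m, 3).
Proof.
move=> n18 le_ball; have n10 : 10 <= n by lia.
have volE := low_volume_binomial m n.
have powE : 2 ^ n = 1024 * 2 ^ (n - 10) by rewrite -{1}(subnKC n10) expnD.
have le_low : low_volume n 1 m 'C(m, 2) <= 604 * 2 ^ (n - 10).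
  case: (leqP (4 * n) m) => le_m; first by have := ball3_leq_bin3 n18 le_m; lia.
  by have := @ball3_leq_exp2 n (m + n) n18; lia.
suff fill : fillable n 1 m 'C(m, 2) by apply: fill; rewrite volE.
rewrite -(subnKC n10); apply: fillable_low_volume => //; rewrite subnKC //.
exact: leq_trans le_low (leq_addr _ _).
Qed.

Definition start_sizes (m : nat) : N * N * N := (1%num, N.of_nat m, N.of_nat 'C(m, 2)).

Lemma sizes_win_greedy n m : greedy_wins n [:: start_sizes m] ->
  ball 3 (m + n) <= 2 ^ n -> sizes_win n 1 m 'C(m, 2) 'C(m, 3).
Proof.
move=> /greedy_winsP/(_ _ (mem_head _ _)).
rewrite /fillableN /= !Nat2N.id => fill le_ball.
by apply: fill; rewrite low_volume_binomial.
Qed.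

(* The largest m with ball 3 (m + n) <= 2 ^ n, for 10 <= n < 18. *)
Definition critical_sizes : seq (nat * nat) :=
  [:: (10, 8); (11, 12); (12, 17); (13, 23); (14, 32); (15, 43); (16, 57); (17, 75)].

Lemma critical_sizes_checked : all (fun p => let: (n, m) := p in
  [&& ball 3 (m + n) <= 2 ^ n, 2 ^ n < ball 3 (m + n).+1
    & greedy_wins n [:: start_sizes m]]) critical_sizes.
Proof. by vm_compute. Qed.

Lemma sizes_win_lt18 m n : 10 <= n < 18 -> ball 3 (m + n) <= 2 ^ n ->
  sizes_win n 1 m 'C(m, 2) 'C(m, 3).
Proof.
move=> n_mid le_ball_m.
have : n \in unzip1 critical_sizes by rewrite (_ : unzip1 _ = iota 10 8) // mem_iota.
case/mapP=> -[_ M] /[swap] /= <-.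
case/(allP critical_sizes_checked)/and3P=> le_ball lt_ball win.
have le_m : m <= M.
  rewrite leqNgt; apply/negP => lt_m.
  have : ball 3 (M + n).+1 <= ball 3 (m + n) by apply: leq_ball; lia.
  by lia.
by apply: leq_sizes_win (sizes_win_greedy win le_ball) => //; apply: leq_bin2l.
Qed.

Lemma berlekampE m q : berlekamp m q = (2 ^ m * ball 3 q <= 2 ^ q).
Proof. by rewrite ballE. Qed.

Lemma berlekampD m n : berlekamp m (m + n) = (ball 3 (m + n) <= 2 ^ n).
Proof. by rewrite berlekampE expnD leq_pmul2l // expn_gt0. Qed.

Lemma berlekamp_leq m q : berlekamp m q -> m <= q.
Proof.
rewrite berlekampE -(leq_exp2l m q (ltnSn 1)); apply: leq_trans.
by rewrite leq_pmulr // (leq_trans _ (leq_ball 3 (leq0n q))).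
Qed.

Lemma Nmin_exists m : exists n, is_Nmin m (m + n).
Proof.
have ex : exists q, berlekamp m q.
  exists (m + (m + 18)); rewrite berlekampD.
  apply: leq_trans (@ball3_leq_exp2 (m + 18) _ _ _) _; try lia.
  by rewrite -[in leqRHS](@subnKC 10 (m + 18)) ?expnD ?leq_mul2r ?orbT //; lia.
case: (ex_minnP ex) => q bq q_min; exists (q - m); rewrite subnKC ?berlekamp_leq //.
by split=> // q' lt_q'; apply: contraL lt_q' => /q_min; rewrite -leqNgt.
Qed.

Lemma is_Nmin_computed m n : ball 3 (m + n) <= 2 ^ n ->
  all (fun q => ~~ (2 ^ m * ball 3 q <= 2 ^ q)) (iota 0 (m + n)) -> is_Nmin m (m + n).
Proof.
move=> le_ball /allP large; split=> [|q lt_q]; first by rewrite berlekampD.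
by rewrite berlekampE; apply: large; rewrite mem_iota.
Qed.

Lemma questions_left_ge10 m n : 6 <= m -> ball 3 (m + n) <= 2 ^ n -> 10 <= n.
Proof.
move=> m6 le_ball; rewrite leqNgt; apply/negP => n9.
have : 2 ^ n < ball 3 (6 + n).
  have /allP : all (fun n => 2 ^ n < ball 3 (6 + n)) (iota 0 10) by [].
  by apply; rewrite mem_iota.
have : ball 3 (6 + n) <= ball 3 (m + n) by apply: leq_ball; lia.
by lia.
Qed.

Lemma Nmin_sizes_win m : m \notin [:: 2; 3; 5] ->
  exists2 n, is_Nmin m (m + n) & sizes_win n 1 m 'C(m, 2) 'C(m, 3).
Proof.
case: (leqP 6 m) => [m6 _ | ].
  have [n Nmin] := Nmin_exists m; exists n => //.
  have := Nmin.1; rewrite berlekampD => le_ball; have n10 := questions_left_ge10 m6 le_ball.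
  case: (ltnP n 18) => n18; last exact: sizes_win_ge18.
  by apply: sizes_win_lt18; rewrite ?n10.
case: m => [|[|[|[|[|[|m]]]]]] // _ _.
- by exists 0; first exact: is_Nmin_computed.
- by exists 6; [apply: is_Nmin_computed | apply: sizes_win_greedy; vm_compute].
- by exists 9; [apply: is_Nmin_computed | apply: sizes_win_greedy; vm_compute].
Qed.

Theorem theorem3 (m : nat) :
  m \notin [:: 2; 3; 5] ->
  exists t : strategy (2 ^ m), perfect t /\ all_questions (@four_interval (2 ^ m)) t.
Proof. by case/Nmin_sizes_win => n; apply: perfect_strategy. Qed.
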